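(* Let $\tau\in\{1,\dots,T\}$ and let $\alpha_\tau\in(0,1)$ be the risk allocated to time $\tau$. Suppose that $\delta\in(0,1)$ and $K>(-\ln\delta)/(2\alpha_\tau^2)$. Then $$\mathbb P\left\{\mathbb E(\beta_\tau)\le\frac{1+N_2\left(\alpha_\tau+\sqrt{-\ln\delta/(2K)}\right)}{1+N_2}\right\}\ge 1-\delta .$$ Furthermore, if $K,N_2\to\infty$, then $\mathbb E(\beta_\tau)\le\alpha_\tau$ holds with probability one.
   Context: Obstacles and data: $M$ obstacles with states in $\mathbb R^{n_p}$; $Y_\tau\in\mathbb R^{Mn_p}$ is the joint obstacle state at time $\tau$. The test trajectory $Y=(Y_0,\dots,Y_T)$ is generated by sampling $Y_0$ from an unknown distribution $\mathcal D$ and evolving it by the obstacle dynamics. The calibration set is $D_{cal}=\{Y^{(1)},\dots,Y^{(N)}\}$, each trajectory being generated by independently sampling an initial state from $\mathcal D$ and evolving it by the same ground truth dynamics, so $Y,Y^{(1)},\dots,Y^{(N)}$ are i.i.d. $D_{cal}$ is split at random into $D_{cal}^1=\{Y^{(1)},\dots,Y^{(K)}\}$ and $D_{cal}^2=\{Y^{(K+1)},\dots,Y^{(K+N_2)}\}$, $K+N_2=N$. A predictor $g$, trained on data independent of $D_{cal}^1$, gives a prediction $\hat Y_{\tau|t}$ of $Y_\tau$ from the joint obstacle states observed up to time $t$, and in the same way a prediction $\hat Y^{(i)}_{\tau|t}$ of $Y^{(i)}_\tau$. The modeling errors are $\omega_\tau=Y_\tau-\hat Y_{\tau|\tau-1}$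 and $\omega^{(i)}_\tau=Y^{(i)}_\tau-\hat Y^{(i)}_{\tau|\tau-1}$; for each $\tau$, $\omega_\tau,\omega^{(1)}_\tau,\dots,\omega^{(N)}_\tau$ are i.i.d. Constraint function: $c:\mathbb R^{n_x}\times\mathbb R^{Mn_p}\to\mathbb R$ is $L_c$-Lipschitz continuous. Prediction radius: $R^{(i)}_{\tau|t}=\|Y^{(i)}_\tau-\hat Y^{(i)}_{\tau|t}\|$, $i=1,\dots,K$, and $$C^{1-a}_{\tau|t}=\mathrm{Quantile}_{1-a}(R^{(1)}_{\tau|t},\dots,R^{(K)}_{\tau|t},\infty)=\inf\{z:\mathbb P\{Z\le z\}\ge1-a\},$$ where $Z$ is distributed according to $\frac1{K+1}\big(\sum_{i=1}^K\delta_{R^{(i)}_{\tau|t}}+\delta_\infty\big)$. Realized state: $x^*_\tau\in\mathbb R^{n_x}$ is the true system state at time $\tau$. It was obtained from the trajectory optimization problem at time $\tau-1$ and is feasible for it; in particular $c(x^*_\tau,\hat Y_{\tau|\tau-1})\ge L_cC^{1-\alpha_\tau}_{\tau|\tau-1}$. It depends on $D_{cal}^1$. Posterior risk: $S^{(K+i)}_\tau=c(x^*_\tau,\hat Y_{\tau|\tau-1}+\omega^{(K+i)}_\tau)$ for $i=1,\dots,N_2$, and $\beta_\tau=\frac1{1+N_2}\big(1+\sum_{i=1}^{N_2}\mathbb I(S^{(K+i)}_\tau<0)\big)$, with $\mathbb I$ the indicator function. Convention: $\mathbb E(\beta_\tau)$ is the expectation given $D_{cal}^1$; the outer probability is with respect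 to $D_{cal}^1$. *)

(* Defs.v *)
From HB Require Import structures.
From mathcomp Require Import all_boot all_order all_algebra.
From mathcomp Require Import all_classical all_reals all_analysis measurable_realfun.

Set Implicit Arguments.
Unset Strict Implicit.
Unset Printing Implicit Defensive.

Import Order.TTheory GRing.Theory Num.Theory.
Import numFieldNormedType.Exports.

Local Open Scope classical_set_scope.
Local Open Scope ring_scope.

(* m x n real matrices with the Borel sigma-algebra of their usual topology. *)
Definition borel_mx (R : realType) (m n : nat) :=
  g_sigma_algebraType (@open 'M[R]_(m, n)).

(* Euclidean norm; the library norm on matrices is the sup norm. *)
Definition l2norm (R : realType) (n : nat) (v : 'rV[R]_n) : R :=
  Num.sqrt (\sum_(j < n) v 0 j ^+ 2).

(* Joint Lipschitz continuity for the Euclidean norm of R^(nx + n). *)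
Definition lipschitz_l2 (R : realType) (nx n : nat) (L : R)
    (c : 'rV[R]_nx -> 'rV[R]_n -> R) : Prop :=
  0 <= L /\
  forall x x' y y',
    `|c x y - c x' y'| <= L * l2norm (row_mx (x - x') (y - y')).

Section Probability.
Local Open Scope ereal_scope.
Variables (d : measure_display) (Omega : measurableType d) (R : realType).
Variable P : probability Omega R.

Section RandomElements.
Variables (d' : measure_display) (S : measurableType d').

Definition mutually_independent (I : set nat) (X : nat -> Omega -> S) : Prop :=
  forall s : seq nat, uniq s -> [set` s] `<=` I ->
  forall B : nat -> set S, (forall i, measurable (B i)) ->
    P (\bigcap_(i in [set` s]) (X i @^-1` B i)) =
    \prod_(i <- s) P (X i @^-1` B i).

Definition identically_distributed (I : set nat) (X : nat -> Omega -> S) :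
    Prop :=
  forall i j, I i -> I j ->
  forall B : set S, measurable B -> P (X i @^-1` B) = P (X j @^-1` B).

Definition iid (I : set nat) (X : nat -> Omega -> S) : Prop :=
  mutually_independent I X /\ identically_distributed I X.

Definition generated_sigma (I : set nat) (X : nat -> Omega -> S) :
    set (set Omega) :=
  <<s \bigcup_(i in I) preimage_set_system setT (X i) measurable >>.

End RandomElements.

(* Z is a version of the conditional expectation E(X | G). *)
Definition is_cond_exp (G : set (set Omega)) (X Z : Omega -> R) : Prop :=
  [/\ P.-integrable setT (EFin \o Z),
      forall B : set R, measurable B -> G (Z @^-1` B) &
      forall A, G A -> \int[P]_(w in A) (Z w)%:E = \int[P]_(w in A) (X w)%:E].

End Probability.

Section Quantile.
Local Open Scope ereal_scope.
Variable R : realType.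

(* Law (sum_(1 <= i <= K) delta_(r i) + delta_oo) / (K + 1) on \bar R. *)
Definition augmented_law (K : nat) (r : nat -> R) (A : set (\bar R)) : \bar R :=
  (K.+1%:R^-1)%:E *
  (\sum_(1 <= i < K.+1) \d_((r i)%:E) A + \d_(+oo : \bar R) A).

Definition quantile (p : R) (K : nat) (r : nat -> R) : \bar R :=
  ereal_inf [set z | p%:E <= augmented_law K r [set Z | Z <= z]].

End Quantile.

Section Planning.
Variables (R : realType) (T n nx : nat).

(* Row t of a trajectory y : 'M_(T.+1, n) is the joint obstacle state at time
   t; [inord] is the identity on the times t <= T. *)
Definition state (y : 'M[R]_(T.+1, n)) (t : nat) : 'rV[R]_n := row (inord t) y.

Definition observed (y : 'M[R]_(T.+1, n)) (t : nat) : 'M[R]_(t.+1, n) :=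
  \matrix_(s < t.+1) state y s.

(* [g tau t] maps the states at times 0..t to a prediction at time tau. *)
Definition predictor := forall tau t : nat, 'M[R]_(t.+1, n) -> 'rV[R]_n.

Definition measurable_predictor (g : predictor) : Prop :=
  forall tau t,
    measurable_fun setT (g tau t : borel_mx R t.+1 n -> borel_mx R 1 n).

Variable g : predictor.

Definition prediction (y : 'M[R]_(T.+1, n)) (tau t : nat) : 'rV[R]_n :=
  g tau (observed y t).

Definition radius (y : 'M[R]_(T.+1, n)) (tau t : nat) : R :=
  l2norm (state y tau - prediction y tau t).

Definition model_error (y : 'M[R]_(T.+1, n)) (tau : nat) : 'rV[R]_n :=
  state y tau - prediction y tau tau.-1.

(* In what follows, Y 0 is the test trajectory and Y i, for i >= 1, is the i-th
   calibration trajectory, all at a given outcome; Y 1, ..., Y K form the first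
   calibration set and Y (K + 1), ..., Y (K + N2) the second one. *)
Variable Y : nat -> 'M[R]_(T.+1, n).

(* C^p_(tau|t) *)
Definition conformal_bound (p : R) (K tau t : nat) : \bar R :=
  quantile p K (fun i => radius (Y i) tau t).

Variables (c : 'rV[R]_nx -> 'rV[R]_n -> R) (xstar : 'rV[R]_nx).

(* If the quantile is +oo then no state is feasible, unless L = 0, where the
   convention 0 * +oo = 0 applies. *)
Definition feasible (L alpha : R) (K tau : nat) : Prop :=
  (L%:E * conformal_bound (1 - alpha) K tau tau.-1 <=
   (c xstar (prediction (Y 0%N) tau tau.-1))%:E)%E.

Definition posterior_score (tau k : nat) : R :=
  c xstar (prediction (Y 0%N) tau tau.-1 + model_error (Y k) tau).

Definition posterior_risk (K N2 tau : nat) : R :=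
  (1 + N2%:R)^-1 *
  (1 + \sum_(1 <= i < N2.+1) (posterior_score tau (K + i) < 0)%R%:R).

End Planning.

(* Main.v *)
Require Import Defs.
From HB Require Import structures.
From mathcomp Require Import all_boot all_order all_algebra.
From mathcomp Require Import all_classical all_reals all_analysis measurable_realfun.
From mathcomp Require Import ring lra.
Import Order.TTheory GRing.Theory Num.Theory.
Import numFieldNormedType.Exports.
Set Implicit Arguments.
Unset Strict Implicit.
Unset Printing Implicit Defensive.
Local Open Scope classical_set_scope.
Local Open Scope ring_scope.

(** A negative posterior score forces a large modeling error.  The constraint
    function is Lipschitz and the realized state keeps the margin [L * C] with
    respect to the predicted obstacles, so [S^(K+i) < 0] is only possible when
    the error of the trajectory [K + i] is larger than the conformal bound [C]
    ([posterior_score_lt0]).  This holds outcome by outcome, hence whatever the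
    dependence between the realized state and the data.

    The random bound [C] is then replaced by a number.  Let [t] be a quantile
    of level [q = 1 - alpha - eps] of the law of the prediction radius, that is
    [P(r < t) <= q <= P(r <= t)] ([exists_quantile]).  If [C < t], then at least
    [K * (1 - alpha)] of the [K] radii of the first calibration set are smaller
    than [t], which exceeds the expected number of such radii by at least
    [K * eps]; Hoeffding's inequality bounds the probability of this event [D K] by
    [exp (- 2 K eps^2)] ([many_visits_tail]).  Off [D K], the posterior risk is
    at most [(1 + sum_i 1(r^(K+i) > t)) / (1 + N2)], where each summand is
    independent of the first calibration set and has mean at most
    [alpha + eps]; since [D K] is determined by that set, the same bound passes
    to the conditional expectation ([posterior_risk_bound]).

    The choice [eps = sqrt (- ln delta / (2 K))] makes the bound on the
    probability of [D K] equal to [delta].  For the limit, [eps] is fixed: the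
    probabilities of the events [D K] are dominated by a geometric sequence, so
    almost surely only finitely many of them occur (Borel-Cantelli), and since
    [D K] depends on neither [N2] nor the realized state, the limit superior
    over [(K, N2)] is at most [alpha + eps]; then [eps] tends to 0. *)

(** * Hoeffding's inequality for Bernoulli variables *)

(** Hoeffding's lemma for a Bernoulli variable.  The difference of the
    logarithms of the two sides vanishes at 0 together with its derivative, and
    its second derivative is [1/4 - u (1 - u) = (1/2 - u)^2], where [u] is the
    success probability of the exponentially tilted variable. *)
Lemma hoeffding_mgf (R : realType) (p r : R) : 0 <= p <= 1 -> 0 <= r ->
  1 - p + p * expR r <= expR (r * p + r ^+ 2 / 8).
Proof.
move=> /andP[p0 p1] r0.
pose v : R -> R := fun x => 1 - p + p * expR x.
pose u : R -> R := fun x => p * expR x / v x.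
have v0 (x : R) : 0 <= x -> 0 < v x.
  move=> x0; have := expR_ge1Dx x; rewrite /v => ex.
  nra.
pose f : R -> R := fun x => x * p + x ^+ 2 / 8 - ln (v x).
pose f1 : R -> R := fun x => p + x / 4 - u x.
have dv (x : R) : is_derive x 1 v (p * expR x).
  rewrite /v; apply: is_derive_eq.
  by rewrite /GRing.scale/=; ring.
have df (x : R) : 0 <= x -> is_derive x 1 f (f1 x).
  move=> x0; have vx0 := v0 _ x0.
  have dlv : is_derive x 1 (@ln R \o v) (u x).
    rewrite /u mulrC; apply: is_derive1_comp.
    exact: is_derive1_ln.
  rewrite /f; apply: is_derive_eq.
  rewrite /f1 /GRing.scale/=.
  by field.
have df1 (x : R) : 0 <= x -> is_derive x 1 f1 (4^-1 - u x * (1 - u x)).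
  move=> x0; have vx0 := v0 _ x0.
  have vn0 : v x != 0 by rewrite gt_eqF.
  have dp : is_derive x 1 (fun y : R => p * expR y) (p * expR x).
    by apply: is_derive_eq; rewrite /GRing.scale/=; ring.
  have dV := is_deriveV vn0 (dv x).
  have du : is_derive x 1 u (u x * (1 - u x)).
    apply: (is_derive_eq (is_deriveM dp dV)).
    by rewrite /GRing.scale/= /u; field.
  rewrite /f1.
  have d4 : is_derive x 1 (fun y : R => p + y / 4) 4^-1.
    by apply: is_derive_eq; rewrite /GRing.scale/=; ring.
  exact: (is_deriveB d4 du).
(* From here on: a function whose derivative is nonnegative on [0, +oo[ is
   bounded below there by its value at 0; used for [f1], then for [f]. *)
have cts (h h' : R -> R) : (forall x : R, 0 <= x -> is_derive x 1 h (h' x)) ->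
    (forall x : R, 0 <= x -> 0 <= h' x) -> forall x : R, 0 <= x -> h 0 <= h x.
  move=> dh h'0 x x0.
  apply: (@ger0_derive1_ndecry _ h 0) => // [y|y|].
  - by rewrite in_itv/= andbT => /ltW y0; case: (dh y y0).
  - rewrite in_itv/= andbT => /ltW y0.
    by rewrite derive1E; case: (dh y y0) => _ ->; exact: h'0.
  - apply: continuous_in_subspaceT => y; rewrite inE/= in_itv/= andbT => y0.
    by case: (dh y y0) => /derivable1_diffP/differentiable_continuous.
have u0 : f1 0 = 0 by rewrite /f1 /u /v expR0; field; rewrite subrK oner_eq0.
have f10 (x : R) : 0 <= x -> 0 <= f1 x.
  move=> x0; rewrite -u0; apply: (cts _ _ df1) => // y y0.
  have -> : 4^-1 - u y * (1 - u y) = (2^-1 - u y) ^+ 2 by field.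
  exact: sqr_ge0.
have := cts _ _ df f10 _ r0.
rewrite /f /v mul0r expR0 mulr1 subrK ln1 expr0n/= mul0r subr0 addr0 subr_ge0.
rewrite -ler_expR lnK ?posrE; last exact: v0.
by [].
Qed.

(** The binomial tail as a sum over the outcomes of [K] coin tosses: bounding
    the indicator of the tail by [exp (r (count - m))] turns the sum into a
    product of moment generating functions. *)
Lemma bernoulli_tail (R : realType) (K : nat) (p eps m : R) :
  0 <= p <= 1 -> 0 <= eps -> K%:R * (p + eps) <= m ->
  \sum_(b : {ffun 'I_K -> bool} | m <= \sum_i (b i)%:R)
     \prod_i (if b i then p else 1 - p) <= expR (- (2 * K%:R * eps ^+ 2)).
Proof.
move=> p01 eps0 Km.
(* [4 * eps] minimizes the exponent [- r eps + r^2 / 8]. *)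
set r := 4 * eps.
have r0 : 0 <= r by rewrite /r mulr_ge0.
have [p0 p1] := andP p01.
pose F (b : {ffun 'I_K -> bool}) : R := \prod_i (if b i then p else 1 - p).
have F0 b : 0 <= F b by apply: prodr_ge0 => i _; case: (b i); lra.
pose tilt (b : {ffun 'I_K -> bool}) : R := expR (r * (\sum_i (b i)%:R - m)).
apply: (@le_trans _ _ (\sum_(b : {ffun 'I_K -> bool}) tilt b * F b)).
  rewrite big_mkcond/=; apply: ler_sum => b _; case: ifPn => [mb|_].
    have tilt1 : 1 <= tilt b.
      by rewrite /tilt -[leLHS](expR0 R) ler_expR mulr_ge0// subr_ge0.
    by rewrite -[leLHS]mul1r; apply: ler_wpM2r => //; exact: F0.
  by rewrite mulr_ge0// expR_ge0.
have -> : \sum_(b : {ffun 'I_K -> bool}) tilt b * F b =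
    expR (- (r * m)) * (1 - p + p * expR r) ^+ K.
  have tiltE b : tilt b * F b =
      expR (- (r * m)) *
      \prod_(i < K) (if b i then p * expR r else 1 - p).
    rewrite /tilt mulrBr expRD mulrAC mulrC; congr (_ * _).
    rewrite mulr_sumr expR_sum -big_split/=; apply: eq_bigr => i _.
    by case: (b i); rewrite ?mulr1 ?mulr0 ?expR0 ?mul1r// mulrC.
  rewrite (eq_bigr _ (fun b _ => tiltE b)) -mulr_sumr; congr (_ * _).
  rewrite -(bigA_distr_bigA
    (fun (_ : 'I_K) c => if c then p * expR r else 1 - p)).
  under eq_bigr do rewrite big_bool/= addrC.
  by rewrite prodr_const card_ord.
apply: (@le_trans _ _ (expR (- (r * m)) * expR (r * p + r ^+ 2 / 8) ^+ K)).
  rewrite ler_wpM2l ?expR_ge0// lerXn2r ?nnegrE ?expR_ge0//.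
    by rewrite addr_ge0 ?mulr_ge0 ?expR_ge0// subr_ge0.
  exact: hoeffding_mgf.
rewrite -expRM_natl -expRD ler_expR.
have /(ler_wpM2l r0) := Km.
rewrite /r; set k := K%:R; nra.
Qed.

(** * Quantiles of a real random variable *)

(** The value is the infimum of the [t] with [q <= cdf t]: the upper bound is
    continuity of the measure from below, the lower bound right continuity of
    the distribution function. *)
Lemma exists_quantile (d : measure_display) (Omega : measurableType d)
    (R : realType) (P : probability Omega R) (X : {RV P >-> R}) (q : R) :
  0 < q < 1 ->
  exists t, (P [set w | (X w < t)%R] <= q%:E <= P [set w | (X w <= t)%R])%E.
Proof.
move=> /andP[q0 q1].
have cdfE t : P [set w | (X w <= t)%R] = cdf X t.
  by congr (P _); apply/seteqP; split=> w /=; rewrite in_itv.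
pose A := [set t | q%:E <= cdf X t]%E.
have A0 : A !=set0.
  have nq : nbhs (1 : \bar R)%E [set x | q%:E < x]%E.
    apply: open_nbhs_nbhs; split; first exact: open_ereal_gt_ereal.
    by rewrite /= lte_fin.
  have : \forall t \near +oo%R, (q%:E < cdf X t)%E by exact: cvg_cdfy1 nq.
  by move/filter_ex => [t /ltW qt]; exists t.
have lbA : has_lbound A.
  have nq : nbhs (0 : \bar R)%E [set x | x < q%:E]%E.
    apply: open_nbhs_nbhs; split; first exact: open_ereal_lt_ereal.
    by rewrite /= lte_fin.
  have : \forall t \near -oo%R, (cdf X t < q%:E)%E by exact: cvg_cdfNy0 nq.
  move/filter_ex => [t tq]; exists t => s qs; rewrite leNgt; apply/negP => st.
  have := lt_le_trans tq qs; rewrite ltNge => /negP; apply.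
  exact/cdf_nondecreasing/ltW.
have infA : has_inf A by split.
exists (inf A); rewrite cdfE; apply/andP; split.
  pose B n := [set w | X w <= inf A - n.+1%:R^-1].
  have -> : [set w | X w < inf A] = \bigcup_n B n.
    apply/seteqP; split=> w /=.
      move=> Xw; exists (Num.truncn (inf A - X w)^-1) => //=.
      rewrite /B/= lerBrDr -lerBrDl -[leRHS]invrK.
      rewrite lef_pV2 ?posrE ?invr_gt0 ?subr_gt0//.
      by rewrite ltW// truncnS_gt.
    move=> [n _ /= /le_lt_trans]; apply.
    by rewrite ltrBlDr ltrDl invr_gt0.
  have ndec : nondecreasing_seq B.
    move=> n m nm; apply/subsetPset => w /=.
    by move=> /le_trans; apply; rewrite lerD2l lerN2 lef_pV2 ?posrE// ler_nat.
  have mB n : measurable (B n).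
    have -> : B n = X @^-1` `]-oo, inf A - n.+1%:R^-1].
      by apply/seteqP; split=> w /=; rewrite in_itv.
    exact: measurable_funPTI.
  have mUB := bigcup_measurable (fun k _ => mB k).
  have cvgB := @nondecreasing_cvg_mu _ _ _ P _ mB (mUB setT) ndec.
  apply: (cvge_le _ cvgB).
  apply: nearW => n /=; rewrite cdfE leNgt; apply/negP => /ltW qn.
  have := ge_inf lbA qn.
  by rewrite lerBrDl gerDr leNgt invr_gt0 ltr0n.
apply: (cvge_ge _ (@cdf_right_continuous _ _ _ P X (inf A))).
near=> y.
have : inf A < y by near: y; exact: nbhs_right_gt.
move=> /(inf_lt A0)[t At ty].
by apply: (le_trans At); exact/cdf_nondecreasing/ltW.
Unshelve. all: by end_near. Qed.
(** * Measurability of the prediction radius *)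

Lemma borel_coord_measurable (R : realType) (m n : nat) (i : 'I_m) (j : 'I_n) :
  measurable_fun setT (fun A : borel_mx R m n => (A : 'M[R]_(m, n)) i j).
Proof.
apply: (measurability _ (RGenOInfty.measurableE R)) => _ [_ [x ->] <-].
rewrite setTI; apply: sub_sigma_algebra.
have /continuousP := @coord_continuous R m n i j.
by apply; exact: rray_open.
Qed.

Lemma observed_measurable (R : realType) (T n t : nat) :
  measurable_fun setT
    (fun y : borel_mx R T.+1 n => observed y t : borel_mx R t.+1 n).
Proof.
apply: (@measurability _ _ (borel_mx R T.+1 n) (borel_mx R t.+1 n) setT _
  (@open 'M[R]_(t.+1, n)) erefl) => _ [U oU <-].
rewrite setTI; apply: sub_sigma_algebra.
suff /continuousP : continuous (fun y : 'M[R]_(T.+1, n) => observed y t) by exact.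
move=> y V /= /nbhs_ballP[e e0 eV].
apply/nbhs_ballP; exists e => // z [_ yz]; apply: eV.
by split => // i j; rewrite !mxE; exact: yz.
Qed.

Lemma radius_measurable (R : realType) (T n : nat) (g : predictor R n)
    (tau t : nat) : measurable_predictor g ->
  measurable_fun setT (fun y : borel_mx R T.+1 n => Defs.radius g y tau t).
Proof.
move=> mg; rewrite /Defs.radius /l2norm.
apply: (@measurableT_comp _ _ _ _ _ _ (@Num.sqrt R)).
  apply: continuous_measurable_fun; exact: sqrt_continuous.
apply: measurable_sum => j; apply: measurable_funX.
under eq_fun do rewrite !mxE.
apply: measurable_funB; first exact: borel_coord_measurable.
have mpred : measurable_fun setT
    (fun y : borel_mx R T.+1 n => prediction g y tau t : borel_mx R 1 n).
  exact: (measurableT_comp (mg tau t) (@observed_measurable R T n t)).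
exact: (measurableT_comp (@borel_coord_measurable R 1 n 0 j) mpred).
Qed.

(** * Independence of a sigma-algebra generated by finitely many variables *)

(** The cylinders over [s] are stable under intersection and generate the
    sigma-algebra; mutual independence says that the two finite measures
    [P (_ `&` X j @^-1` B)] and [P (X j @^-1` B) * P _] agree on them. *)
Lemma generated_sigma_independent (d : measure_display)
    (Omega : measurableType d) (R : realType) (P : probability Omega R)
    (d' : measure_display) (S : measurableType d') (X : nat -> Omega -> S)
    (I : set nat) (s : seq nat) (j : nat) :
  (forall i, measurable_fun setT (X i)) ->
  mutually_independent P I X -> uniq (j :: s) -> [set` j :: s] `<=` I ->
  forall E B, generated_sigma [set` s] X E -> measurable B ->
  (P (E `&` X j @^-1` B) = P E * P (X j @^-1` B))%E.
Proof.
move=> mX indX ujs sI E B GE mB.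
have mXB i C : measurable C -> measurable (X i @^-1` C).
  by move=> mC; rewrite -[X in measurable X]setTI; exact: mX.
have js : j \notin s by case/andP: ujs.
pose cyl (C : nat -> set S) := \bigcap_(i in [set` s]) (X i @^-1` C i).
pose H := [set A | exists2 C, (forall i, measurable (C i)) & A = cyl C].
have mcyl C : (forall i, measurable (C i)) -> measurable (cyl C).
  move=> mC; apply: fin_bigcap_measurable; first exact: finite_seq.
  by move=> i _; exact: mXB.
pose m1 : {measure set Omega -> \bar R} := mrestr P (mXB j B mB).
have PB_ge0 : 0 <= fine (P (X j @^-1` B)) by rewrite fine_ge0.
pose m2 : {measure set Omega -> \bar R} := mscale (NngNum PB_ge0) P.
have m2E A : (m2 A = P A * P (X j @^-1` B))%E.
  rewrite /m2/= /mscale/= fineK ?fin_num_measure//; first by rewrite muleC.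
  exact: (mXB _ _ mB).
have indH A : H A -> m1 A = m2 A.
  move=> [C mC ->]; rewrite m2E /m1/= /mrestr.
  pose C' i := if i == j then B else C i.
  have mC' i : measurable (C' i) by rewrite /C'; case: ifP.
  have C's i : i \in s -> C' i = C i.
    by move=> si; rewrite /C'; case: eqP => // ij; rewrite -ij si in js.
  have -> : cyl C `&` X j @^-1` B = \bigcap_(i in [set` j :: s]) (X i @^-1` C' i).
    apply/seteqP; split=> [w [sw jw] i /=|w jsw].
      rewrite inE => /predU1P[->|si]; first by rewrite /C' eqxx.
      by rewrite C's//; exact: sw.
    split=> [i /= si|].
      by have := jsw i; rewrite /= inE si orbT C's//; apply.
    by have := jsw j; rewrite /= inE eqxx /C' eqxx; apply.
  have us : uniq s by case/andP: ujs.
  rewrite indX// big_cons /C' eqxx muleC; congr (_ * _)%E.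
  rewrite /cyl indX//; last by move=> i /= si; apply: sI; rewrite /= inE si orbT.
  by apply: eq_big_seq => i si; have := C's _ si; rewrite /C' => ->.
have HI : setI_closed H.
  move=> _ _ [C mC ->] [D mD ->]; exists (fun i => C i `&` D i).
    by move=> i; exact: measurableI.
  apply/seteqP; split=> [w [Cw Dw] i si|w CDw].
    by split; [exact: Cw|exact: Dw].
  by split=> i si; case: (CDw i si).
have HE : [set A | H A /\ A `<=` setT] = H.
  by apply/seteqP; split=> [A []//|A HA]; split.
rewrite -m2E -[LHS]/(m1 E).
apply: (@g_sigma_algebra_measure_unique_trace _ _ _ H setT) => //; rewrite ?HE //.
- by move=> A [C mC ->]; exact: mcyl.
- by rewrite m2E /m1/= /mrestr setTI probability_setT mul1e.
- rewrite /m1/= /mrestr setTI (le_lt_trans (probability_le1 _ _))// ?ltry//.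
  exact: (mXB _ _ mB).
- move: GE; apply: smallest_sub; first exact: smallest_sigma_algebra.
  move=> A [i /= si [C mC <-]]; apply: sub_gen_smallest.
  exists (fun k => if k == i then C else setT).
    by move=> k; case: ifP.
  rewrite setTI; apply/seteqP; split=> w /=.
    by move=> Cw k /= sk; case: eqP => // ->.
  by move=> /(_ i si); rewrite eqxx.
Qed.

(** * Number of variables that fall in a given set *)

Definition many_visits (R : realType) (Omega S : Type) (X : nat -> Omega -> S)
    (A : set S) (K : nat) (m : R) : set Omega :=
  [set w | m <= \sum_(1 <= i < K.+1) \1_A (X i w)].

(** Written as a finite intersection of preimages to match the definition of
    independence; the position [i - 1] of [b] stands for [X i]. *)
Definition pattern_event (Omega S : Type) (X : nat -> Omega -> S)
    (A : set S) (K : nat) (b : {ffun 'I_K -> bool}) : set Omega :=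
  \bigcap_(i in [set` iota 1 K])
    (X i @^-1` if oapp b false (insub i.-1) then A else ~` A).

Lemma pattern_eventP (Omega S : Type) (X : nat -> Omega -> S)
    (A : set S) (K : nat) (b : {ffun 'I_K -> bool}) w :
  pattern_event X A b w <-> b = [ffun i : 'I_K => X i.+1 w \in A].
Proof.
split=> [bw|-> i /=].
  apply/ffunP => i; rewrite ffunE.
  have := bw i.+1; rewrite /= mem_iota/= add1n ltnS ltn_ord valK/= => /(_ isT).
  by case: (b i) => /= Aw; [rewrite mem_set|rewrite memNset].
rewrite mem_iota add1n; case: i => // i; rewrite ltnS /= => iK.
rewrite insubT/= ffunE /=; case: ifPn => [/set_mem//|].
by move/negP => h Aw; apply: h; exact/mem_set.
Qed.

(** Cutting the event into patterns reduces its measurability to that of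
    cylinders and its probability to a sum of products. *)
Lemma many_visitsE (R : realType) (Omega S : Type) (X : nat -> Omega -> S)
    (A : set S) (K : nat) (m : R) :
  many_visits X A K m =
  \big[setU/set0]_(b : {ffun 'I_K -> bool} | m <= \sum_i (b i)%:R)
    pattern_event X A b.
Proof.
have sumE w : \sum_(1 <= i < K.+1) \1_A (X i w) =
    \sum_i ([ffun i : 'I_K => X i.+1 w \in A] i)%:R :> R.
  rewrite big_add1 big_mkord; apply: eq_bigr => i _.
  by rewrite ffunE indicE.
rewrite -bigcup_seq_cond; apply/seteqP; split=> w.
  rewrite /many_visits/= sumE => mw.
  exists [ffun i : 'I_K => X i.+1 w \in A]; last exact/pattern_eventP.
  by rewrite /= mem_index_enum.
move=> [b /= /andP[_ mb] /pattern_eventP bw].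
by rewrite /many_visits/= sumE -bw.
Qed.

Section many_visits_probability.
Context (d : measure_display) (Omega : measurableType d) (R : realType).
Context (P : probability Omega R) (d' : measure_display) (S : measurableType d').
Context (X : nat -> Omega -> S) (A : set S) (K : nat).
Hypothesis mX : forall i, measurable_fun setT (X i).
Hypothesis mA : measurable A.

Let side_measurable (c : bool) : measurable (if c then A else ~` A).
Proof. by case: c => //; exact: measurableC. Qed.

Lemma many_visits_generated (m : R) :
  generated_sigma [set` iota 1 K] X (many_visits X A K m).
Proof.
pose GT := g_sigma_algebraType
  (\bigcup_(i in [set` iota 1 K]) preimage_set_system setT (X i) measurable).
rewrite many_visitsE -[generated_sigma _ _ _]/(measurable (_ : set GT)).
apply: bigsetU_measurable => b _.
apply: fin_bigcap_measurable; first exact: finite_seq.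
move=> i /= iK; apply: sub_gen_smallest; exists i => //=.
exists (if oapp b false (insub i.-1) then A else ~` A); last by rewrite setTI.
exact: side_measurable.
Qed.

(** Hoeffding's inequality: each pattern has a product probability, so that
    subadditivity leaves the sum of [bernoulli_tail]. *)
Lemma many_visits_tail (I : set nat) (p eps m : R) :
  mutually_independent P I X -> [set` iota 1 K] `<=` I ->
  (forall i, (1 <= i <= K)%N -> P (X i @^-1` A) = p%:E) ->
  0 <= p <= 1 -> 0 <= eps -> K%:R * (p + eps) <= m ->
  (P (many_visits X A K m) <= (expR (- (2 * K%:R * eps ^+ 2)))%:E)%E.
Proof.
move=> indX KI PA p01 eps0 Km.
have mXB i B : measurable B -> measurable (X i @^-1` B).
  by move=> mB; rewrite -[X in measurable X]setTI; exact: mX.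
apply: (@le_trans _ _ (\sum_(b : {ffun 'I_K -> bool} | m <= \sum_i (b i)%:R)
     \prod_i (if b i then p else 1 - p))%:E); last first.
  by rewrite lee_fin; exact: bernoulli_tail.
rewrite many_visitsE -sumEFin.
pose good (U : set Omega) x := measurable U /\ (P U <= x)%E.
suff [] : good (\big[setU/set0]_(b : {ffun 'I_K -> bool} | m <= \sum_i (b i)%:R)
    pattern_event X A b)
    (\sum_(b : {ffun 'I_K -> bool} | (m <= \sum_i (b i)%:R)%R)
     (\prod_i (if b i then p else 1 - p)%R)%:E)%E by [].
apply: (big_ind2 good) => [|U x V y [mU Ux] [mV Vy]|b _].
- by split => //; rewrite measure0.
- split; first exact: measurableU.
  by apply: (le_trans (measureU2 _ _ _)) => //; exact: leeD.
split.
  apply: fin_bigcap_measurable; first exact: finite_seq.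
  by move=> i _; apply: mXB; exact: side_measurable.
rewrite /pattern_event (indX _ _ KI
  (fun i => if oapp b false (insub i.-1) then A else ~` A)) ?iota_uniq//.
have -> : iota 1 K = index_iota 1 K.+1 by rewrite /index_iota subn1.
rewrite big_add1 big_mkord -prodEFin le_eqVlt; apply/orP; left; apply/eqP.
apply: eq_bigr => i _; rewrite valK/=.
have PAi : P (X i.+1 @^-1` A) = p%:E by rewrite PA//= ltn_ord.
case: (b i) => //=.
by rewrite preimage_setC probability_setC ?PAi//; exact: mXB.
Qed.
End many_visits_probability.

(** * From a negative score to a large modeling error *)

(** Below [t], the augmented law only charges the sample points that are smaller
    than [t], since its extra atom is at infinity. *)
Lemma quantile_ge (R : realType) (p : R) (K : nat) (r : nat -> R) (t : R) :
  \sum_(1 <= i < K.+1) \1_[set x | x < t] (r i) < p * K.+1%:R ->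
  (t%:E <= quantile p K r)%E.
Proof.
move=> few; apply: le_ereal_inf_tmp => z /= pz; rewrite leNgt; apply/negP => zt.
move: pz; rewrite leNgt => /negP; apply.
rewrite /augmented_law diracE memNset/=; last first.
  by apply/negP; rewrite -ltNge (lt_le_trans zt)// leey.
rewrite adde0 lte_pdivrMl// muleC -EFinM.
apply: (@le_lt_trans _ _ (\sum_(1 <= i < K.+1) \1_[set x | x < t] (r i))%:E);
  last by rewrite lte_fin.
rewrite -sumEFin; apply: lee_sum => i _; rewrite diracE indicE lee_fin ler_nat.
case: (boolP (_ \in [set Z | Z <= z]%E)) => //; rewrite inE/= => rz.
by rewrite mem_set//= -lte_fin (le_lt_trans rz).
Qed.

(** Adding the modeling error to the prediction moves [c] by at most [L] times
    the radius, while feasibility gives [L * t <= L * C <= c].  Working with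
    [L * t] rather than [t] covers [L = 0] and an infinite [C] at once. *)
Lemma posterior_score_lt0 (R : realType) (T n nx : nat) (g : predictor R n)
    (Y : nat -> 'M[R]_(T.+1, n)) (c : 'rV[R]_nx -> 'rV[R]_n -> R)
    (x : 'rV[R]_nx) (L alpha t : R) (K tau k : nat) :
  lipschitz_l2 L c -> feasible g Y c x L alpha K tau ->
  (t%:E <= conformal_bound g Y (1 - alpha) K tau tau.-1)%E ->
  posterior_score g Y c x tau k < 0 ->
  t < Defs.radius g (Y k) tau tau.-1.
Proof.
move=> [L0 lipc] feas tC S0.
set y0 := prediction g (Y 0%N) tau tau.-1 in feas *.
have cL : c x y0 - posterior_score g Y c x tau k <=
    L * Defs.radius g (Y k) tau tau.-1.
  apply: (le_trans (ler_norm _)); apply: (le_trans (lipc _ _ _ _)).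
  rewrite ler_wpM2l// /posterior_score -/y0 subrr opprD addrA subrr add0r.
  rewrite le_eqVlt; apply/orP; left; apply/eqP.
  rewrite /Defs.radius -/(model_error g (Y k) tau) /l2norm; congr Num.sqrt.
  rewrite big_split_ord/= big1 ?add0r => [|j _]; last first.
    by rewrite row_mxEl mxE expr0n.
  by apply: eq_bigr => j _; rewrite row_mxEr !mxE sqrrN.
rewrite ltNge; apply/negP => /(ler_wpM2l L0) Lr.
have : (L%:E * t%:E <= (c x y0)%:E)%E.
  by apply: le_trans feas; apply: lee_wpmul2l.
rewrite -EFinM lee_fin; lra.
Qed.

(** * Upper bounds on conditional expectations *)

(** The integral of a nonnegative function is a supremum over the simple
    functions below it, hence it is monotone without measurability.  This is
    what the posterior risk calls for: its conditional expectation is defined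
    through its integrals alone. *)
Lemma ge0_le_integral_nonmeasurable (d : measure_display) (T : measurableType d)
    (R : realType) (mu : {measure set T -> \bar R}) (D : set T)
    (f h : T -> \bar R) :
  (forall x, D x -> (0 <= f x <= h x)%E) ->
  (\int[mu]_(x in D) f x <= \int[mu]_(x in D) h x)%E.
Proof.
move=> fh.
have f0 x : D x -> (0 <= f x)%E by move=> /fh /andP[].
have h0 x : D x -> (0 <= h x)%E by move=> /fh /andP[] /le_trans; apply.
rewrite !ge0_integralE//; apply: le_ereal_sup => _ [s /= sf <-].
exists s => // x; apply: (le_trans (sf x)); rewrite /patch.
by case: ifPn => // /set_mem /fh /andP[].
Qed.

Section conditional_expectation.
Context (d : measure_display) (Omega : measurableType d) (R : realType).
Context (P : probability Omega R) (U : set (set Omega)).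
Let G := <<s U>>.
Hypothesis Gm : forall A, G A -> measurable A.

Let GI A B : G A -> G B -> G (A `&` B).
Proof. exact: (@measurableI _ (g_sigma_algebraType U)). Qed.

(** On the event [F] where the conditional expectation [Z] exceeds [b] inside
    [E], the integral of [Z - b > 0] is at most 0, so that [F] is null. *)
Lemma cond_exp_le (X Z : Omega -> R) (h : Omega -> \bar R) (E : set Omega)
    (b : R) :
  is_cond_exp P G X Z -> G E ->
  (forall w, E w -> (0 <= (X w)%:E <= h w)%E) ->
  (forall F, G F -> F `<=` E -> (\int[P]_(w in F) h w <= b%:E * P F)%E) ->
  P (E `&` [set w | b < Z w]) = 0%E.
Proof.
move=> [intZ GZ ZX] GE Xh hb.
set F := E `&` _.
have GF : G F.
  apply: GI => //; have := GZ `]b, +oo[%classic (measurable_itv _).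
  by congr G; apply/seteqP; split=> w /=; rewrite in_itv/= andbT.
have mF := Gm GF.
have intZF : P.-integrable F (EFin \o Z) by apply: integrableS intZ.
have intbF : P.-integrable F (cst b%:E).
  by apply: finite_measure_integrable_cst.
have Zb : (\int[P]_(w in F) ((Z w)%:E - b%:E) <= 0)%E.
  have bF : (\int[P]_(w in F) b%:E = b%:E * P F)%E by exact: integral_cst.
  rewrite integralB// bF leeBlDr ?add0e; last first.
    by rewrite fin_numM// fin_num_measure.
  rewrite ZX//; apply: le_trans (hb F GF (@subIsetl _ _ _)).
  by apply: ge0_le_integral_nonmeasurable => w [Ew _]; exact: Xh.
have Zb0 w : F w -> (0 <= (Z w)%:E - b%:E)%E.
  by move=> [_ /= /ltW bZ]; rewrite -EFinB lee_fin subr_ge0.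
have abs0 : (\int[P]_(w in F) `|(Z w)%:E - b%:E| = 0)%E.
  rewrite (eq_integral (fun w => (Z w)%:E - b%:E)%E) => [|w /set_mem Fw].
    by apply/eqP; rewrite eq_le Zb integral_ge0.
  by rewrite gee0_abs// Zb0.
have mZb : measurable_fun F (fun w => (Z w)%:E - b%:E)%E.
  apply: emeasurable_funB; first exact: measurable_int intZF.
  exact: measurable_int intbF.
have /(ae_eq_integral_abs P mF mZb) [N [mN PN subN]] := abs0.
apply/eqP; rewrite -measure_le0 -PN le_measure ?inE//.
move=> w Fw; apply: subN => /= /(_ Fw) /eqP; rewrite -EFinB eqe subr_eq0.
by move=> /eqP Zw; case: Fw => _; rewrite /= Zw ltxx.
Qed.

(** The exceptional null set [N0] is added to every [B i]: the dominating average
    is then equal to 1 on it, which is enough as [X <= 1]. *)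
Lemma cond_exp_average_le (X Z : Omega -> R) (N : nat) (B : nat -> set Omega)
    (N0 E : set Omega) (a : R) :
  is_cond_exp P G X Z -> G E ->
  (forall i, measurable (B i)) -> P.-negligible N0 ->
  (forall w, 0 <= X w <= 1) ->
  (forall w, E w -> ~ N0 w ->
    X w <= (1 + N%:R)^-1 * (1 + \sum_(1 <= i < N.+1) \1_(B i) w)) ->
  (forall i F, (1 <= i <= N)%N -> G F -> (P (F `&` B i) <= a%:E * P F)%E) ->
  P (E `&` [set w | (1 + N%:R * a) / (1 + N%:R) < Z w]) = 0%E.
Proof.
move=> cZ GE mB [M [mM PM0 N0M]] X01 XB FB.
have N1 : 0 < 1 + N%:R :> R by rewrite ltr_wpDr.
pose C i := B i `|` M.
have mC i : measurable (C i) by exact: measurableU.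
pose h w : \bar R :=
  ((1 + N%:R)^-1%:E * (1 + \sum_(1 <= i < N.+1) (\1_(C i) w)%:E))%E.
apply: (@cond_exp_le X Z h) => //.
  move=> w Ew; rewrite lee_fin; have /andP[-> /=] := X01 w.
  rewrite /h sumEFin -EFinD -EFinM lee_fin.
  have [Mw|Mw] := pselect (M w).
    move=> /le_trans; apply; rewrite ler_pdivlMl// mulr1 lerD2l.
    rewrite (eq_bigr (fun=> 1)) => [|i _].
      by rewrite sumr_const_nat subn1.
    by rewrite indicE mem_set//; right.
  move=> _; apply: (le_trans (XB _ Ew _)); first by move/N0M.
  apply: ler_wpM2l; first by rewrite invr_ge0 ltW.
  rewrite lerD2l; apply: ler_sum => i _.
  rewrite !indicE ler_nat; case: (boolP (w \in B i)) => // /set_mem Bw.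
  by rewrite mem_set//; left.
move=> F GF _; have mF := Gm GF.
have N1e : (0 <= (1 + N%:R)^-1%:E :> \bar R)%E by rewrite lee_fin invr_ge0 ltW.
have mI i : measurable_fun F (fun w => (\1_(C i) w)%:E : \bar R).
  by apply/measurable_EFinP; exact: measurable_indic.
rewrite ge0_integralZl//; last 2 first.
  apply: emeasurable_funD; first exact: measurable_cst.
  exact: emeasurable_sum.
  by move=> w _; apply: adde_ge0 => //; apply: sume_ge0 => i _; rewrite lee_fin.
rewrite ge0_integralD//; last 2 first.
  by move=> w _; apply: sume_ge0 => i _; rewrite lee_fin.
  exact: emeasurable_sum.
rewrite integral_cst// mul1e ge0_integral_sum//.
have FC i : (1 <= i <= N)%N -> (\int[P]_(w in F) (\1_(C i) w)%:E <= a%:E * P F)%E.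
  move=> iN; rewrite integral_indic// setIC.
  apply: le_trans (FB i F iN GF).
  rewrite /C setIUr (le_trans (measureU2 _ _ _))//; try exact: measurableI.
  rewrite [X in (_ + X)%E](_ : _ = 0%E) ?adde0//.
  by apply/eqP; rewrite -measure_le0 -PM0 le_measure ?inE//; exact: measurableI.
apply: (@le_trans _ _ ((1 + N%:R)^-1%:E *
    (P F + \sum_(1 <= i < N.+1) a%:E * P F))%E).
  apply: lee_wpmul2l => //; apply: leeD => //.
  rewrite big_nat_cond [leRHS]big_nat_cond; apply: lee_sum => i.
  by rewrite andbT ltnS => /FC.
rewrite -(@fineK _ (P F)) ?fin_num_measure//; set x := fine _.
have -> : (\sum_(1 <= i < N.+1) a%:E * x%:E = (\sum_(1 <= i < N.+1) a * x)%:E)%E.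
  by rewrite -sumEFin.
rewrite -EFinD -!EFinM lee_fin.
rewrite sumr_const_nat subn1/= -mulr_natl le_eqVlt; apply/orP; left; apply/eqP.
by field; rewrite gt_eqF.
Qed.
End conditional_expectation.

(** * The posterior risk given the first calibration set *)

Lemma generated_sigma_measurable (d d' : measure_display)
    (Omega : measurableType d) (S : measurableType d') (I : set nat)
    (X : nat -> Omega -> S) :
  (forall i, measurable_fun setT (X i)) ->
  generated_sigma I X `<=` measurable.
Proof.
move=> mX; apply: smallest_sub; first exact: sigma_algebra_measurable.
by move=> _ [i _ [B mB <-]]; exact: mX.
Qed.

Lemma iid_subset (d d' : measure_display) (Omega : measurableType d)
    (R : realType) (P : probability Omega R) (S : measurableType d')
    (I J : set nat) (X : nat -> Omega -> S) :
  I `<=` J -> iid P J X -> iid P I X.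
Proof.
move=> IJ [indX idX]; split=> [s us sI|i j Ii Ij].
  exact: indX _ us (subset_trans sI IJ).
exact: idX (IJ _ Ii) (IJ _ Ij).
Qed.

(** The exceptional event [D K] depends only on the law of a trajectory and on
    the first calibration set, not on [N2], on the realized state or on the
    version of the conditional expectation: the Borel-Cantelli argument relies
    on this. *)
Lemma posterior_risk_bound (R : realType) (d : measure_display)
    (Omega : measurableType d) (P : probability Omega R) (T n nx : nat)
    (c : 'rV[R]_nx -> 'rV[R]_n -> R) (L : R) (g : predictor R n)
    (tau : nat) (alpha eps : R) (Y : nat -> {RV P >-> borel_mx R T.+1 n}) :
  lipschitz_l2 L c -> measurable_predictor g -> 0 < alpha < 1 -> 0 < eps ->
  exists D : nat -> set Omega,
    (forall K, iid P [set i | (i <= K)%N] (fun i w => Y i w) ->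
      measurable (D K) /\
      (P (D K) <= (expR (- (2 * K%:R * eps ^+ 2)))%:E)%E) /\
    (forall (K N2 : nat) (xstar : Omega -> 'rV[R]_nx) (Ebeta : Omega -> R),
      iid P [set i | (i <= K + N2)%N] (fun i w => Y i w) ->
      {ae P, forall w, feasible g (fun i => Y i w) c (xstar w) L alpha K tau} ->
      is_cond_exp P
        (generated_sigma [set i | (1 <= i <= K)%N] (fun i w => Y i w))
        (fun w => posterior_risk g (fun i => Y i w) c (xstar w) K N2 tau)
        Ebeta ->
      P (~` D K `&` [set w | (1 + N2%:R * (alpha + eps)) / (1 + N2%:R) <
                             Ebeta w]) = 0%E).
Proof.
move=> lipc mg /andP[alpha0 alpha1] eps0.
pose X i w : borel_mx R T.+1 n := Y i w.
have mX i : measurable_fun setT (X i) by exact: measurable_funPT.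
have mXB i B : measurable B -> measurable (X i @^-1` B).
  by move=> mB; rewrite -[X in measurable X]setTI; exact: mX.
have iotaE K : [set i | (1 <= i <= K)%N] = [set` iota 1 K].
  by apply/seteqP; split=> i /=; rewrite mem_iota add1n ltnS.
have risk01 K N2 xs w :
    0 <= posterior_risk g (fun i => Y i w) c xs K N2 tau <= 1.
  have N1 : 0 < 1 + N2%:R :> R by rewrite ltr_wpDr.
  rewrite /posterior_risk; apply/andP; split.
    apply: mulr_ge0; first by rewrite invr_ge0 ltW.
    by apply: addr_ge0 => //; apply: sumr_ge0.
  rewrite ler_pdivrMl// mulr1 lerD2l.
  apply: (@le_trans _ _ (\sum_(1 <= i < N2.+1) 1)).
    by apply: ler_sum => i _; case: (_ < _).
  by rewrite sumr_const_nat subn1.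
set q := 1 - (alpha + eps).
have q1 : q < 1 by rewrite /q; lra.
(* When [q <= 0] a quantile of level [q] need not exist, but then
   [1 <= alpha + eps] and the bound holds as the risk is at most 1. *)
have [q0|q0] := leP q 0.
  exists (fun=> set0); split=> [K _|K N2 xstar Ebeta _ feas cE].
    by split => //; rewrite measure0 lee_fin expR_ge0.
  apply: (cond_exp_average_le _ cE _ (fun=> measurableT) feas) => //.
  - exact: generated_sigma_measurable.
  - by rewrite setC0; exact: (@measurableT _ (g_sigma_algebraType _)).
  - move=> w _ _; have /andP[_] := risk01 K N2 (xstar w) w.
    move=> /le_trans; apply; rewrite ler_pdivlMl ?ltr_wpDr// mulr1 lerD2l.
    rewrite (eq_bigr (fun=> 1)) => [|i _]; last by rewrite indicE in_setT.
    by rewrite sumr_const_nat subn1.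
  - move=> i F iN GF; rewrite setIT -[leLHS]mul1e; apply: lee_wpmul2r => //.
    by rewrite lee_fin; move: q0; rewrite /q; lra.
have mrad := @radius_measurable R T n g tau tau.-1 mg.
pose r0 w : R := Defs.radius g (X 0%N w) tau tau.-1.
have mr0 : measurable_fun setT r0 by exact: (measurableT_comp mrad (mX 0%N)).
pose r0RV : {RV P >-> R} :=
  HB.pack r0 (isMeasurableFun.Build _ _ _ _ r0 mr0).
have [|t /andP[Pt qP]] := @exists_quantile _ _ _ P r0RV q; first by rewrite q0.
pose A := [set y : borel_mx R T.+1 n | Defs.radius g y tau tau.-1 < t].
pose B := [set y : borel_mx R T.+1 n | t < Defs.radius g y tau tau.-1].
have mA : measurable A.
  have := mrad measurableT `]-oo, t[%classic (measurable_itv _).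
  by rewrite setTI; congr measurable; apply/seteqP; split=> y /=; rewrite in_itv.
have mB : measurable B.
  have := mrad measurableT `]t, +oo[%classic (measurable_itv _).
  rewrite setTI; congr measurable;
    by apply/seteqP; split=> y /=; rewrite in_itv/= andbT.
have P0A : (P (X 0%N @^-1` A) <= q%:E)%E by [].
have P0B : (P (X 0%N @^-1` B) <= (alpha + eps)%:E)%E.
  have -> : X 0%N @^-1` B = ~` [set w | r0 w <= t].
    by apply/seteqP; split=> w; rewrite /preimage /B /r0/= ltNge => /negP.
  rewrite probability_setC; last first.
    have := mr0 measurableT `]-oo, t]%classic (measurable_itv _).
    rewrite setTI; congr measurable;
      by apply/seteqP; split=> w /=; rewrite in_itv.
  have -> : alpha + eps = 1 - q by rewrite /q subKr.
  by rewrite EFinB; exact: leeB.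
(* Off this event fewer than [(K + 1) * (1 - alpha)] radii are below [t], so
   that the conformal bound is at least [t]. *)
exists (fun K => many_visits X A K (K%:R * (1 - alpha))).
split=> [K [indX idX]|K N2 xstar Ebeta [indX idX] feas cE].
  split.
    apply: (generated_sigma_measurable mX); exact: many_visits_generated.
  pose p := fine (P (X 0%N @^-1` A)).
  have pE : p%:E = P (X 0%N @^-1` A).
    by rewrite fineK// fin_num_measure//; exact: mXB.
  apply: (many_visits_tail mX mA (p := p) indX) => //; last 4 first.
  - by move=> i /andP[_ iK]; rewrite pE; exact: idX.
  - by rewrite -!lee_fin pE measure_ge0 probability_le1//; exact: mXB.
  - exact: ltW.
  - rewrite ler_wpM2l// -lerBrDr; move: P0A; rewrite -pE lee_fin /q; lra.
  by move=> i /=; rewrite mem_iota add1n ltnS => /andP[].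
have GD := many_visits_generated (X := X) (K := K) mA (K%:R * (1 - alpha)).
rewrite iotaE in cE.
apply: (cond_exp_average_le _ cE _ (fun i => mXB (K + i)%N B mB) feas) => //.
- exact: generated_sigma_measurable.
- exact: (@measurableC _ (g_sigma_algebraType _)).
- move=> w nD /contrapT feasw.
  have tC : (t%:E <=
      conformal_bound g (fun i => Y i w) (1 - alpha) K tau tau.-1)%E.
    apply: quantile_ge.
    apply: (@lt_le_trans _ _ (K%:R * (1 - alpha))).
      by rewrite ltNge; apply/negP => mw; apply: nD.
    by rewrite mulrC ler_wpM2l ?ler_nat// subr_ge0 ltW.
  apply: ler_wpM2l; first by rewrite invr_ge0 addr_ge0.
  rewrite lerD2l; apply: ler_sum => i _; rewrite indicE ler_nat.
  case: (boolP (_ < 0)) => // sc; rewrite mem_set//.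
  exact: posterior_score_lt0 lipc feasw tC sc.
- move=> i F /andP[i0 iN] GF.
  rewrite (generated_sigma_independent mX indX _ _ GF mB); last 2 first.
  + have Ki : (K < K + i)%N by rewrite -{1}[K]addn0 ltn_add2l.
    by rewrite /= iota_uniq andbT mem_iota add1n ltnS [(_ <= K)%N]leqNgt Ki andbF.
  + move=> k /=; rewrite inE => /predU1P[->|]; first by rewrite leq_add2l.
    by rewrite mem_iota add1n ltnS => /andP[_ /leq_trans]; apply; exact: leq_addr.
  rewrite muleC; apply: lee_wpmul2r => //.
  by rewrite (idX (K + i)%N 0%N)//= leq_add2l.
Qed.

(** * Almost sure limit *)

Lemma geometric_lim_sup_set (d : measure_display) (Omega : measurableType d)
    (R : realType) (P : probability Omega R) (D : nat -> set Omega) (a : R) :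
  0 <= a < 1 -> (forall k, measurable (D k)) ->
  (forall k, (P (D k) <= (a ^+ k)%:E)%E) -> P.-negligible (lim_sup_set D).
Proof.
move=> /andP[a0 a1] mD Da.
have mL : measurable (lim_sup_set D).
  by apply: bigcapT_measurable => n; apply: bigcup_measurable => k _.
exists (lim_sup_set D); split => //; apply: lim_sup_set_cvg0 => //.
apply: (@le_lt_trans _ _ (1 / (1 - a))%:E); last exact: ltry.
apply: lime_le; first exact: is_cvg_nneseries.
apply: nearW => n; apply: (@le_trans _ _ (\sum_(0 <= k < n) a ^+ k)%:E).
  by rewrite -sumEFin; apply: lee_sum => k _; exact: Da.
have an1 : a != 1 by rewrite lt_eqF.
have -> : \sum_(0 <= k < n) a ^+ k = 1 * (1 - a ^+ n) / (1 - a).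
  have /(congr1 (fun f => f n)) /= <- := geometric_seriesE 1 an1.
  by rewrite /series/=; apply: eq_bigr => k _; rewrite mul1r.
rewrite lee_fin mul1r ler_pM2r ?invr_gt0 ?subr_gt0//.
by rewrite gerBl exprn_ge0.
Qed.

Theorem corollaryA2 (R : realType) (d : measure_display)
    (Omega : measurableType d) (P : probability Omega R)
    (T M np nx : nat)
    (c : 'rV[R]_nx -> 'rV[R]_(M * np) -> R) (Lc : R)
    (g : predictor R (M * np))
    (tau : nat) (alpha : R) :
  lipschitz_l2 Lc c ->
  measurable_predictor g ->
  (1 <= tau <= T)%N ->
  0 < alpha < 1 ->
  (forall (K N2 : nat) (delta : R)
      (Y : nat -> {RV P >-> borel_mx R T.+1 (M * np)})
      (xstar : {RV P >-> borel_mx R 1 nx})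
      (Ebeta : Omega -> R),
    iid P [set i | (i <= K + N2)%N] (fun i w => Y i w) ->
    {ae P, forall w, feasible g (fun i => Y i w) c (xstar w) Lc alpha K tau} ->
    is_cond_exp P
      (generated_sigma [set i | (1 <= i <= K)%N] (fun i w => Y i w))
      (fun w => posterior_risk g (fun i => Y i w) c (xstar w) K N2 tau)
      Ebeta ->
    0 < delta < 1 ->
    - ln delta / (2 * alpha ^+ 2) < K%:R ->
    ((1 - delta)%:E <=
      P [set w | (Ebeta w <=
        (1 + N2%:R * (alpha + Num.sqrt (- ln delta / (2 * K%:R)))) /
        (1 + N2%:R))%R])%E)
  /\
  (forall (Y : nat -> {RV P >-> borel_mx R T.+1 (M * np)})
      (xstar : nat -> nat -> {RV P >-> borel_mx R 1 nx})
      (Ebeta : nat -> nat -> Omega -> R),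
    iid P [set: nat] (fun i w => Y i w) ->
    (\forall KN \near filter_prod \oo \oo,
      {ae P, forall w,
        feasible g (fun i => Y i w) c (xstar KN.1 KN.2 w) Lc alpha KN.1 tau}) ->
    (forall K N2,
      is_cond_exp P
        (generated_sigma [set i | (1 <= i <= K)%N] (fun i w => Y i w))
        (fun w =>
           posterior_risk g (fun i => Y i w) c (xstar K N2 w) K N2 tau)
        (Ebeta K N2)) ->
    {ae P, forall w,
      (limf_esup (fun KN : nat * nat => (Ebeta KN.1 KN.2 w)%:E)
         (filter_prod \oo \oo) <= alpha%:E)%E}).
Proof.
move=> lipc mg _ alpha01; have [alpha0 alpha1] := andP alpha01; split.
  move=> K N2 delta Y xstar Ebeta iidY feas cE /andP[delta0 delta1] Kbig.
  have lnd0 : 0 < - ln delta by rewrite oppr_gt0 ln_lt0// delta0.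
  have K0 : 0 < K%:R :> R.
    apply: le_lt_trans Kbig; apply: divr_ge0; first exact: ltW.
    by apply: mulr_ge0 => //; exact: sqr_ge0.
  set eps := Num.sqrt _.
  have eps0 : 0 < eps by rewrite sqrtr_gt0 divr_gt0// mulr_gt0.
  have eps2 : 2 * K%:R * eps ^+ 2 = - ln delta.
    by rewrite sqr_sqrtr ?divr_ge0 ?mulr_ge0 ?ltW//; field; rewrite gt_eqF.
  have [D [PD DE]] := posterior_risk_bound tau Y lipc mg alpha01 eps0.
  have iidK : iid P [set i | (i <= K)%N] (fun i w => Y i w).
    by apply: iid_subset iidY => i /= /leq_trans; apply; exact: leq_addr.
  have [mD] := PD K iidK; rewrite eps2 opprK lnK ?posrE// => PDdelta.
  have := DE K N2 xstar Ebeta iidY feas cE.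
  set bnd := (1 + _) / _ => PE0.
  set E := [set w | Ebeta w <= bnd].
  have mE : measurable E.
    have [_ GE _] := cE.
    have := GE `]-oo, bnd]%classic (measurable_itv _).
    move/(generated_sigma_measurable (fun i => measurable_funPT (Y i))).
    by congr measurable; apply/seteqP; split=> w /=; rewrite in_itv.
  have CE : ~` E = [set w | bnd < Ebeta w].
    by apply/seteqP; split=> w; rewrite /E/= ltNge => /negP.
  have PCE : (P (~` E) <= delta%:E)%E.
    apply: le_trans PDdelta; rewrite -[leRHS]adde0 -[X in (_ + X)%E]PE0 -CE.
    have mCE : measurable (~` D K `&` ~` E).
      by apply: measurableI; exact: measurableC.
    apply: le_trans (measureU2 _ mD mCE).
    rewrite le_measure ?inE//; [exact: measurableC|exact: measurableU|].
    by move=> w nE; have [Dw|nD] := pselect (D K w); [left|right].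
  have := probability_setC P mE.
  rewrite -(@fineK _ (P E)) ?fin_num_measure// => PC.
  by move: PCE; rewrite PC -EFinB !lee_fin; lra.
move=> Y xstar Ebeta iidY [[A B] [[K1 _ AK1] [N1 _ BN1]] AB] cE.
have epsk k : 0 < k.+1%:R^-1 :> R by rewrite invr_gt0.
have /choice[D PDE] k := posterior_risk_bound tau Y lipc mg alpha01 (epsk k).
have iidn n : iid P [set i | (i <= n)%N] (fun i w => Y i w).
  exact: iid_subset iidY.
(* The tolerances [1 / (k + 1)] are countably many, so that a single null set
   takes care of all of them, and of all [K] and [N2]. *)
pose bnd k N : R := (1 + N%:R * (alpha + k.+1%:R^-1)) / (1 + N%:R).
pose V k K N := if (K1 <= K)%N && (N1 <= N)%N then
  ~` D k K `&` [set w | bnd k N < Ebeta K N w] else set0.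
have nV k K N : P.-negligible (V k K N).
  rewrite /V; case: ifP => [/andP[K1K N1N]|_]; last exact: negligible_set0.
  have [[mD _] DE] := ((PDE k).1 K (iidn _), (PDE k).2).
  have feas := AB (K, N) (conj (AK1 K K1K) (BN1 N N1N)).
  exists (~` D k K `&` [set w | bnd k N < Ebeta K N w]); split => //.
    apply: measurableI; first exact: measurableC.
    have [_ GE _] := cE K N.
    have := GE `]bnd k N, +oo[%classic (measurable_itv _).
    move/(generated_sigma_measurable (fun i => measurable_funPT (Y i))).
    by congr measurable; apply/seteqP; split=> w /=; rewrite in_itv/= andbT.
  exact: (DE K N (xstar K N) (Ebeta K N) (iidn _) feas (cE K N)).
have nL k : P.-negligible (lim_sup_set (D k)).
  apply: (@geometric_lim_sup_set _ _ _ _ _ (expR (- (2 * k.+1%:R^-1 ^+ 2)))).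
  - by rewrite expR_ge0/= expR_lt1 oppr_lt0 mulr_gt0// exprn_gt0.
  - by move=> K; have [] := (PDE k).1 K (iidn _).
  move=> K; have [_] := (PDE k).1 K (iidn _).
  rewrite -expRM_natl; congr (_ <= (expR _)%:E)%E; ring.
pose bad := \bigcup_k (lim_sup_set (D k) `|` \bigcup_K \bigcup_N V k K N).
have nbad : P.-negligible bad.
  apply: negligible_bigcup => k; apply: negligibleU => //.
  by apply: negligible_bigcup => K; exact: negligible_bigcup.
apply: negligibleS nbad => w /=; apply: contra_notP => nbadw.
apply/lee_addgt0Pr => e e0.
(* With [1 / (k + 1) <= e / 2], one half of [e] pays for the tolerance and the
   other half for the term [1 / (1 + N)], as [k <= N]. *)
pose k := Num.truncn (e / 2)^-1.
have ke : k.+1%:R^-1 <= e / 2.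
  rewrite -[leRHS]invrK lef_pV2 ?posrE ?invr_gt0 ?divr_gt0//.
  by rewrite ltW// truncnS_gt.
have [n Dn] : exists n, forall K, (n <= K)%N -> ~ D k K w.
  apply: contrapT => nD; apply: nbadw; exists k => //; left => m _.
  apply: contrapT => nDm; apply: nD; exists m => K mK DK; apply: nDm.
  by exists K.
apply: ge_ereal_inf.
exists (ereal_sup [set (Ebeta KN.1 KN.2 w)%:E | KN in
    [set KN | (maxn n K1 <= KN.1)%N /\ (maxn k N1 <= KN.2)%N]]).
  eexists; last reflexivity.
  exists ([set K | (maxn n K1 <= K)%N], [set N | (maxn k N1 <= N)%N]) => /=.
    by split; [exists (maxn n K1)|exists (maxn k N1)].
  by move=> [K N].
apply: ge_ereal_sup => _ [[K N] /= [+ +] <-].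
rewrite !geq_max => /andP[nK K1K] /andP[kN N1N].
have Eb : Ebeta K N w <= bnd k N.
  rewrite leNgt; apply/negP => bE; apply: nbadw; exists k => //; right.
  by exists K => //; exists N => //; rewrite /V K1K N1N; split => //; exact: Dn.
rewrite -EFinD lee_fin; apply: (le_trans Eb).
have N0 : 0 < 1 + N%:R :> R by rewrite ltr_wpDr.
have Nk : (1 + N%:R)^-1 <= k.+1%:R^-1 :> R.
  by rewrite lef_pV2 ?posrE// -(natrD _ 1%N) ler_nat add1n ltnS.
have bE : bnd k N =
    (1 + N%:R)^-1 * (1 - (alpha + k.+1%:R^-1)) + (alpha + k.+1%:R^-1).
  by rewrite /bnd; move: (alpha + _) => s; field; rewrite gt_eqF.
have Ns : 0 <= (1 + N%:R)^-1 * (alpha + k.+1%:R^-1).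
  by apply/ltW/mulr_gt0; [rewrite invr_gt0|exact: addr_gt0].
apply: (@le_trans _ _ (k.+1%:R^-1 + (alpha + k.+1%:R^-1))).
  by rewrite bE lerD2r (le_trans _ Nk)// mulrBr mulr1 gerBl.
by move: ke; move: (k.+1%:R^-1) => x; lra.
Qed.
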